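(* Let $(M,\rho)$ be a complete metric space, let $(X,E_v)$ be a vertical rooted graph with $\mathcal J_1(x)\ne\emptyset$ for all $x\in X$, and let $\Phi$ be an index map on $(X,E_v)$ over $(M,\rho)$ of exponential type-$(b)$ for some $b\in(0,\infty)$, with attractor $K$. Fix $\gamma>0$ and let $(X,E^{(b)})$ be the associated $AI_b$-graph. Then $(X,E^{(b)})$ is $(m,1)$-departing for some $m\ge1$, and hence hyperbolic. Moreover, the index map $\Phi$ induces a bijection $\kappa:\partial X\to K$ that is a Hölder equivalence, i.e., there is a constant $C\ge1$ such that $$C^{-1}\theta_a(\xi,\eta)\le\rho(\kappa(\xi),\kappa(\eta))^{a/b}\le C\,\theta_a(\xi,\eta),\qquad\forall\ \xi,\eta\in\partial X.$$
   Context: A rooted graph $(X,E)$ is a countable vertex set $X$ with a symmetric edge set $E\subset X\times X\setminus\Delta$ ($\Delta$ the diagonal) that is locally finite and connected, with a fixed root $\vartheta\in X$. Let $d$ be the graph distance, $|x|:=d(\vartheta,x)$, $X_n=\{x:|x|=n\}$. $\mathcal J_m(x)$ is the set of $y$ with $|y|=|x|+m$ such that $x$ lies on some geodesic from $\vartheta$ to $y$. Let $E_h=\{(x,y)\in E:|x|=|y|\}$, $E_v=E\setminus E_h$; $d_h$ is the graph distance on $(X,E_h)$ ($=\infty$ if no path exists). The graph is vertical if $E=E_v$. For positive integers $m,k$ it is $(m,k)$-departing if for $x,y\in X$: $d_h(x,y)>k$ implies $d_h(u,v)>2k$ for all $u\in\mathcal J_m(x)$, $v\in\mathcal J_m(y)$.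 $\mathcal R_v$ denotes the set of rays $\mathbf x=[x_i]_{i\ge0}$ with $x_0=\vartheta$ and $x_{i+1}\in\mathcal J_1(x_i)$ for all $i$. The Gromov product is $(x|y)=\frac12(|x|+|y|-d(x,y))$; $(X,E)$ is hyperbolic if there is $\delta\ge0$ with $(x|y)\ge\min\{(x|z),(z|y)\}-\delta$ for all $x,y,z\in X$. Then for a fixed $a>0$ with $e^{\delta a}<\sqrt2$, the Gromov metric on $X$ is $\theta_a(x,y)=\inf\{\sum_{i=1}^n e^{-a(x_{i-1}|x_i)}: n\ge1,\ x=x_0,\dots,x_n=y\in X\}$ for $x\neq y$, $\theta_a(x,x)=0$; $\widehat X$ is the $\theta_a$-completion and $\partial X=\widehat X\setminus X$ the hyperbolic boundary with the extended metric $\theta_a$. Every ray in $\mathcal R_v$ is $\theta_a$-Cauchy and converges to a point of $\partial X$, and (for the graphs considered) every point of $\partial X$ is the limit of a ray in $\mathcal R_v$. Let $\mathcal C_M$ be the family of nonempty compact subsets of $M$. An index map on $(X,E_v)$ over $(M,\rho)$ is a map $\Phi:X\to\mathcal C_M$ with $\Phi(y)\subset\Phi(x)$ for all $x\in X$, $y\in\mathcal J_1(x)$, and such that $\bigcap_{i\ge0}\Phi(x_i)$ is a singleton for every $[x_i]_i\in\mathcal R_v$. Its attractor is $K=\bigcap_{n\ge0}\bigcup_{x\in X_n}\Phi(x)$. It is of exponential type-$(b)$ if $|\Phi(x)|_\rho=O(e^{-b|x|})$ as $|x|\to\infty$ ($|\cdot|_\rho$ = diameter). Put $\{\kappa_0(\mathbf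 x)\}=\bigcap_{i\ge0}\Phi(x_i)$ for $\mathbf x\in\mathcal R_v$. ''$\Phi$ induces a bijection $\kappa:\partial X\to K$'' means that $\kappa(\xi):=\kappa_0(\mathbf x)$, for any ray $\mathbf x\in\mathcal R_v$ converging to $\xi$, is well defined and is a bijection. The $AI_b$-graph (for fixed $\gamma>0$) is $(X,E^{(b)})$ with $E^{(b)}=E_v\cup E_h^{(b)}$, $E_h^{(b)}=\bigcup_{n\ge1}\{(x,y)\in X_n\times X_n\setminus\Delta:\operatorname{dist}_\rho(\Phi(x),\Phi(y))\le\gamma e^{-bn}\}$. *)

(* Defs.v *)
From HB Require Import structures.
From mathcomp Require Import all_boot all_order all_algebra.
From mathcomp Require Import all_classical all_reals all_analysis.

Set Implicit Arguments.
Unset Strict Implicit.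
Unset Printing Implicit Defensive.

Import Order.TTheory GRing.Theory Num.Theory.
Import numFieldNormedType.Exports.

Local Open Scope classical_set_scope.
Local Open Scope ring_scope.

#[short(type="completeMetricType")]
HB.structure Definition CompleteMetric (R : numDomainType) :=
  { M of Metric R M & Complete M }.

Section RootedGraphs.
Context {X : countType}.
Implicit Types (E : rel X) (o x y u v : X) (m k n : nat).

Definition joined E x y n : Prop :=
  exists p : seq X, [/\ path E x p, last x p = y & size p = n].

Record rooted_graph E : Prop := RootedGraph {
  graph_irr : irreflexive E;
  graph_sym : symmetric E;
  graph_locfin : forall x, finite_set [set y | E x y];
  graph_conn : forall x y, exists n, joined E x y n }.

Lemma joined_bool E x y :
  (exists n, joined E x y n) -> exists n, `[< joined E x y n >].
Proof. by move=> [n jn]; exists n; apply/asboolP. Qed.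

(* Graph distance with values in nat extended by infinity, written [None]. *)
Definition graph_edist E x y : option nat :=
  if pselect (exists n, joined E x y n) is left ex
  then Some (ex_minn (joined_bool ex)) else None.

Definition edist_gt (d : option nat) k : bool :=
  if d is Some n then (k < n)%N else true.

(* Used on connected graphs only, where the default value 0 plays no role. *)
Definition gdist E x y : nat := odflt 0%N (graph_edist E x y).

Definition level E o x : nat := gdist E o x.

Definition geodesic E x y (p : seq X) : Prop :=
  [/\ path E x p, last x p = y & size p = gdist E x y].

Definition descendants E o m x : set X :=
  [set y | level E o y = (level E o x + m)%N /\
           exists2 p, geodesic E o y p & x \in o :: p].

Definition hor_edge E o : rel X :=
  [rel x y | E x y && (level E o x == level E o y)].

Definition ver_edge E o : rel X :=
  [rel x y | E x y && ~~ hor_edge E o x y].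

Definition vertical E o : Prop := E =2 ver_edge E o.

Definition departing E o m k : Prop :=
  forall x y, edist_gt (graph_edist (hor_edge E o) x y) k ->
  forall u v, descendants E o m x u -> descendants E o m y v ->
    edist_gt (graph_edist (hor_edge E o) u v) (2 * k).

Definition ray E o (r : nat -> X) : Prop :=
  r 0%N = o /\ forall i, descendants E o 1 (r i) (r i.+1).

End RootedGraphs.

Section Completion.
Context {R : realType} {T : Type} (d : T -> T -> R).
Implicit Types (u v : nat -> T).

Definition cauchy_seq u : Prop :=
  forall e : R, 0 < e ->
  exists N, forall i j, (N <= i)%N -> (N <= j)%N -> d (u i) (u j) < e.

Definition cauchy_class u : set (nat -> T) :=
  [set v | cauchy_seq v /\ d (u n) (v n) @[n --> \oo] --> (0 : R)].

(* Points are equivalence classes of Cauchy sequences, so that Leibniz equality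
   is the equality of the completion. *)
Record completion := Completion {
  class_of : set (nat -> T);
  class_ofP : exists2 u, cauchy_seq u & class_of = cauchy_class u }.

Definition class_repr (xi : completion) : nat -> T :=
  projT1 (cid2 (class_ofP xi)).

(* When d is a metric, the limit exists and does not depend on the choice of
   the representatives. *)
Definition completion_dist (xi eta : completion) : R :=
  limn (fun n => d (class_repr xi n) (class_repr eta n)).

Hypothesis dxx : forall x, d x x = 0.

Lemma cauchy_cst x : cauchy_seq (fun=> x).
Proof. by move=> e e0; exists 0%N => i j _ _; rewrite dxx. Qed.

Definition completion_in x : completion :=
  Completion (ex_intro2 _ _ (fun=> x) (cauchy_cst x) erefl).

Definition remainder : set completion :=
  [set xi | forall x, xi <> completion_in x].

Definition converges_to u (xi : completion) : Prop :=
  completion_dist (completion_in (u n)) xi @[n --> \oo] --> (0 : R).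

End Completion.

Section Hyperbolicity.
Context {R : realType} {X : countType}.
Implicit Types (E : rel X) (o x y z : X) (delta a : R).

Definition gromov_prod E o x y : R :=
  ((level E o x)%:R + (level E o y)%:R - (gdist E x y)%:R) / 2.

Definition hyperbolic_with E o delta : Prop :=
  0 <= delta /\
  forall x y z, Num.min (gromov_prod E o x z) (gromov_prod E o z y) - delta
                <= gromov_prod E o x y.

Definition theta E o a x y : R :=
  if x == y then 0 else
  inf [set s : R | exists n (c : nat -> X),
         [/\ (1 <= n)%N, c 0%N = x, c n = y &
           s = \sum_(i < n) expR (- a * gromov_prod E o (c i) (c i.+1))]].

Lemma theta_xx E o a x : theta E o a x x = 0.
Proof. by rewrite /theta eqxx. Qed.

Definition boundary E o a : set (completion (theta E o a)) :=
  remainder (theta_xx E o a).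

Definition tends_to E o a (r : nat -> X) (xi : completion (theta E o a)) :=
  converges_to (theta_xx E o a) r xi.

End Hyperbolicity.

Arguments boundary {R X} E o a.

Definition hyperbolic (R : realType) (X : countType) (E : rel X) (o : X) :=
  exists delta : R, hyperbolic_with E o delta.

Section IndexMaps.
Context {R : realType} {X : countType} {M : metricType R}.
Implicit Types (E : rel X) (o : X) (A B : set M) (Phi : X -> set M).

Definition diameter A : R :=
  sup [set s : R | exists p q, [/\ A p, A q & s = mdist p q]].

Definition set_dist A B : R :=
  inf [set s : R | exists p q, [/\ A p, B q & s = mdist p q]].

Record is_index_map E o Phi : Prop := IndexMap {
  index_neq0 : forall x, Phi x !=set0;
  index_compact : forall x, compact (Phi x);
  index_sub : forall x y, descendants E o 1 x y -> Phi y `<=` Phi x;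
  index_ray : forall r, ray E o r ->
    exists p, \bigcap_(i in [set: nat]) Phi (r i) = [set p] }.

Definition attractor E o Phi : set M :=
  \bigcap_(n in [set: nat]) \bigcup_(x in [set x | level E o x = n]) Phi x.

Definition exponential_type E o Phi (b : R) : Prop :=
  exists (c : R) (N : nat), forall x, (N <= level E o x)%N ->
    diameter (Phi x) <= c * expR (- b * (level E o x)%:R).

(* The graph with vertical edges E and horizontal edges prescribed by Phi. *)
Definition AI_graph E o Phi (b gamma : R) : rel X :=
  [rel x y | E x y ||
    [&& (1 <= level E o x)%N, level E o x == level E o y, x != y &
        set_dist (Phi x) (Phi y) <= gamma * expR (- b * (level E o x)%:R)]].

(* Ev carries the rays and the index map, E the boundary. Every boundary point
   is the limit of a ray, and all rays with that limit yield the same point of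
   the attractor, namely its image under kappa. *)
Definition induces Ev E o (a : R) Phi
    (kappa : completion (theta E o a) -> M) : Prop :=
  forall xi, boundary E o a xi ->
    (exists2 r, ray Ev o r & tends_to r xi) /\
    forall r, ray Ev o r -> tends_to r xi ->
      \bigcap_(i in [set: nat]) Phi (r i) = [set kappa xi].

End IndexMaps.

(* Main.v *)
(** For [p] in [Phi x] and [q] in [Phi y], the quantities [e^(-b(x|y))] and
    [rho(p,q) + e^(-b|x|) + e^(-b|y|)] are comparable. Upper bound on
    [rho(p,q)]: along a geodesic of the AI-graph the sets [Phi] move by at most a
    multiple of [e^(-b level)], and the levels are at least those of a path that
    descends to level [(x|y)] and climbs back, so the sum is geometric. Lower
    bound: at the last level where the ancestors of [x] and [y] may be joined by
    a horizontal edge, one gets a path through that edge. Hyperbolicity is then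
    the triangle inequality of [rho]; the departing property comes from the upper
    bound on horizontal paths of length at most 2. Finally [theta_a] is
    comparable to [e^(-a(x|y))] by the chain lemma of Frink, and rays represent
    all boundary points and all points of the attractor by Koenig's lemma, so
    that passing to the limit along rays gives the Hoelder equivalence. *)
Require Import Defs.
From HB Require Import structures.
From mathcomp Require Import all_boot all_order all_algebra.
From mathcomp Require Import all_classical all_reals all_analysis.
From mathcomp Require Import zify ring lra.

Set Implicit Arguments.
Unset Strict Implicit.
Unset Printing Implicit Defensive.

Import Order.TTheory GRing.Theory Num.Theory.
Import numFieldNormedType.Exports.

Local Open Scope classical_set_scope.
Local Open Scope ring_scope.

(** * Paths, levels and descendants in rooted graphs; Koenig's lemma *)

Section Graphs.
Context {X : countType}.
Implicit Types (E : rel X) (o x y z : X) (m n : nat).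

Lemma joined0 E x : joined E x x 0.
Proof. by exists [::]. Qed.

Lemma joined_nil E x y : joined E x y 0 -> x = y.
Proof. by move=> [[|z p] [_ /= yE]]. Qed.

Lemma joined_cat E x y z m n :
  joined E x y m -> joined E y z n -> joined E x z (m + n).
Proof.
move=> [p [Ep py sp]] [q [Eq qz sq]]; exists (p ++ q).
by rewrite cat_path last_cat size_cat py Ep Eq qz sp sq.
Qed.

Lemma joined_split E x z m n : joined E x z (m + n) ->
  exists2 y, joined E x y m & joined E y z n.
Proof.
move=> [p [Ep pz sp]]; move: Ep pz sp; rewrite -{1 2}(cat_take_drop m p).
rewrite cat_path last_cat => /andP[E1 E2] pz sp.
exists (last x (take m p)); first by exists (take m p); rewrite size_takel// sp leq_addr.
by exists (drop m p); rewrite size_drop sp addKn.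
Qed.

Lemma joined1P E x y : joined E x y 1 <-> E x y.
Proof.
split=> [[[|z [|w p]] [//= + zy _]]|Exy]; first by rewrite andbT -zy.
by exists [:: y]; rewrite /= Exy.
Qed.

Lemma joinedSP E x z n :
  joined E x z n.+1 <-> exists2 y, joined E x y n & E y z.
Proof.
rewrite -addn1; split=> [/joined_split[y xy /joined1P yz]|[y xy /joined1P yz]].
  by exists y.
exact: joined_cat xy yz.
Qed.

Lemma joined_sym E x y n : symmetric E -> joined E x y n -> joined E y x n.
Proof.
move=> Esym; elim: n y => [y /joined_nil ->|n IHn y]; first exact: joined0.
move=> /joinedSP[z /IHn zx zy]; rewrite -add1n; apply: joined_cat zx.
by apply/joined1P; rewrite Esym.
Qed.

Lemma joined_sub E E' x y n :
  subrel E E' -> joined E x y n -> joined E' x y n.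
Proof.
by move=> EE' [p [Ep py sp]]; exists p; split=> //; apply: sub_path Ep.
Qed.

(** At infinite distance there is no path and the right-hand side is vacuous, so later arguments can
    speak of paths only. *)
Lemma edist_gtP E x y k :
  edist_gt (graph_edist E x y) k <-> forall n, joined E x y n -> (k < n)%N.
Proof.
rewrite /graph_edist; case: pselect => [ex|nex] /=; last first.
  by split=> // _ n jn; case: nex; exists n.
case: ex_minnP => d /asboolP jd dmin; split=> [kd n jn|]; last exact.
by rewrite (leq_trans kd)//; apply: dmin; apply/asboolP.
Qed.

Lemma gdist_le E x y n : joined E x y n -> (gdist E x y <= n)%N.
Proof.
move=> jn; rewrite /gdist /graph_edist.
case: pselect => //= ex; case: ex_minnP => d _; apply; exact/asboolP.
Qed.

Lemma gdist_joined E x y :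
  (exists n, joined E x y n) -> joined E x y (gdist E x y).
Proof.
move=> jn; rewrite /gdist /graph_edist; case: pselect => //= ex.
by case: ex_minnP => d /asboolP.
Qed.

Lemma level_root E o : level E o o = 0%N.
Proof. by apply/eqP; rewrite -leqn0; apply: gdist_le (joined0 E o). Qed.

Section Connected.
Variables (E : rel X) (o : X).
Hypothesis conn : forall x y, exists n, joined E x y n.

Lemma level_joined x y n :
  joined E x y n -> (level E o y <= level E o x + n)%N.
Proof.
move=> xy; apply: gdist_le; apply: joined_cat xy; exact: gdist_joined.
Qed.

(** A vertex on a geodesic from the root cuts it in two parts. Neither part can be shorter than the
    level difference it bridges, and the total length then fixes both. Conversely, a geodesic to [x]
    prolonged by a path of length [m] has length [level E o y], hence is a geodesic. *)
Lemma descendantsP m x y : descendants E o m x y <->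
  level E o y = (level E o x + m)%N /\ joined E x y m.
Proof.
split=> [[ylev [p [+ + +] xp]]|[ylev xy]].
  case/splitPl: xp => p1 p2 p1x; rewrite cat_path last_cat size_cat p1x.
  move=> /andP[E1 E2] p2y; rewrite -/(level E o y) ylev => sp; split=> //.
  have ox : joined E o x (@size X p1) by exists p1.
  have xy : joined E x y (@size X p2) by exists p2.
  have := gdist_le ox; rewrite -/(level E o x); have := level_joined xy.
  by move=> le1 le2; have -> : m = @size X p2 by lia.
split=> //; have [|p [Ep px sp]] := @gdist_joined E o x; first exact: conn.
have [q [Eq qy sq]] := xy; exists (p ++ q).
  split; rewrite ?cat_path ?last_cat ?px ?Ep//.
  by rewrite size_cat sp sq -/(level E o y) ylev.
by rewrite -px -cat_cons mem_cat mem_last.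
Qed.

Lemma descendants0 x : descendants E o 0 x x.
Proof. by apply/descendantsP; rewrite addn0; split=> //; exact: joined0. Qed.

Lemma descendants_root x : descendants E o (level E o x) o x.
Proof.
by apply/descendantsP; rewrite level_root add0n; split=> //; exact: gdist_joined.
Qed.

Lemma descendants_trans m n x y z : descendants E o m x y ->
  descendants E o n y z -> descendants E o (m + n) x z.
Proof.
move=> /descendantsP[yx xy] /descendantsP[zy yz]; apply/descendantsP.
by rewrite zy yx addnA; split=> //; exact: joined_cat xy yz.
Qed.

Lemma descendants_split m n x z : descendants E o (m + n) x z ->
  exists2 y, descendants E o m x y & descendants E o n y z.
Proof.
move=> /descendantsP[zx /joined_split[y xy yz]]; exists y; apply/descendantsP.
  by split=> //; have := level_joined xy; have := level_joined yz; lia.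
by split=> //; have := level_joined xy; have := level_joined yz; lia.
Qed.

Lemma ray_level r i : ray E o r -> level E o (r i) = i.
Proof.
move=> [r0 rS]; elim: i => [|i IHi]; first by rewrite r0 level_root.
by have /descendantsP[-> _] := rS i; rewrite IHi addn1.
Qed.

Lemma ray_descendants r i n : ray E o r -> descendants E o n (r i) (r (i + n)%N).
Proof.
move=> [_ rS]; elim: n => [|n IHn]; first by rewrite addn0; exact: descendants0.
by rewrite addnS -addn1; apply: descendants_trans IHn _.
Qed.

(** The ray is built inside the vertices that have descendants in every [W n]. The root is one of
    them, and local finiteness passes the property on to some child. It is applied to tails of
    Cauchy sequences and to the vertices whose index set contains a given point. *)
Lemma konig (W : nat -> set X) :
  (forall x, finite_set [set y | E x y]) ->
  (forall n, W n !=set0) -> (forall n w, W n w -> (n <= level E o w)%N) ->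
  (forall n, W n.+1 `<=` W n) ->
  exists2 r, ray E o r & forall i n, exists w m,
    [/\ W n w, (i <= level E o w)%N & descendants E o m (r i) w].
Proof.
move=> fin W0 Wlev WS.
have Wle m n : (m <= n)%N -> W n `<=` W m.
  move=> /subnKC <-; elim: (n - m)%N => [|k IHk]; first by rewrite addn0.
  by rewrite addnS; exact: subset_trans (WS _) IHk.
pose Q x := forall n, exists w m, W n w /\ descendants E o m x w.
have QS x : Q x -> exists y, Q y /\ descendants E o 1 x y.
  move=> Qx; apply: contrapT => /forallNP noy.
  have /choice[f fP] : forall y, exists n, descendants E o 1 x y ->
      forall w m, W n w -> ~ descendants E o m y w.
    move=> y; have [xy|] := pselect (descendants E o 1 x y); last by exists 0%N.
    have := noy y => /not_andP[|//] /existsNP[n nP]; exists n => _ w m Wnw ym.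
    by apply: nP; exists w, m.
  have finxy : finite_set [set y | descendants E o 1 x y].
    apply: sub_finite_set (fin x) => y /= /descendantsP[_].
    by move=> /joined1P.
  have /finite_fsetP[s sE] := finxy.
  (* The first entry forces members of [W N] strictly below the level of [x], so that a path to them
     passes through a child [y]; the second gives [W N] inside [W (f y)], which misses all
     descendants of [y]. *)
  pose N := maxn (level E o x).+1 (\max_(y <- finmap.enum_fset s) f y).
  have [w [m [Ww xw]]] := Qx N.
  case: m => [|m] in xw.
    have /descendantsP[wx _] := xw.
    by have := Wlev _ _ Ww; rewrite wx addn0 /N geq_max ltnn.
  rewrite -add1n in xw; have [y xy yw] := descendants_split xw.
  apply: (fP y xy w m) yw; apply: Wle Ww; rewrite /N leq_max; apply/orP; right.
  have ys : y \in finmap.enum_fset s.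
    by have : [set y | descendants E o 1 x y] y by []; rewrite sE.
  exact: leq_bigmax_seq.
have Qo : Q o.
  by move=> n; have [w Ww] := W0 n; exists w, (level E o w); split=> //; exact: descendants_root.
have /choice[g gP] : forall x, exists y, Q x -> Q y /\ descendants E o 1 x y.
  move=> x; have [/QS[y yP]|] := pselect (Q x); last by exists x.
  by exists y.
pose r i := iter i g o.
have Qr i : Q (r i) by elim: i => //= i /gP[].
have rr : ray E o r by split=> // i; have [_] := gP _ (Qr i).
exists r => // i n; have [w [m [Ww rw]]] := Qr i n; exists w, m; split=> //.
by have /descendantsP[-> _] := rw; rewrite ray_level// leq_addr.
Qed.

End Connected.

End Graphs.

Arguments descendantsP {X E o} conn {m x y}.

(** * Convergence to zero of nonnegative sequences *)

Section NonnegSequences.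
Context {R : realType}.
Implicit Types s t : nat -> R.

Lemma cvg0P s : (forall n, 0 <= s n) ->
  (s n @[n --> \oo] --> (0 : R)) <->
  forall e : R, 0 < e -> exists N, forall n, (N <= n)%N -> s n < e.
Proof.
move=> s0; split=> [/cvgrPdist_lt H e e0|H].
  have [N _ Ns] := H _ e0.
  by exists N => n Nn; have := Ns n Nn; rewrite /= sub0r normrN ger0_norm.
apply/cvgrPdist_lt => e e0; have [N Ns] := H e e0; exists N => // n /= Nn.
by rewrite sub0r normrN ger0_norm//; exact: Ns.
Qed.

Lemma squeeze0 s t : (forall n, 0 <= s n) -> (forall n, s n <= t n) ->
  t n @[n --> \oo] --> (0 : R) -> s n @[n --> \oo] --> (0 : R).
Proof.
move=> s0 st t0; apply: (squeeze_cvgr (f := fun=> 0) (h := t)) => //.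
  by apply: nearW => n; rewrite s0 st.
exact: cvg_cst.
Qed.

End NonnegSequences.

(** * The completion as a space of classes of Cauchy sequences *)

Section PseudometricCompletion.
Context {R : realType} {T : Type} (d : T -> T -> R).
Hypothesis dxx : forall x, d x x = 0.
Hypothesis dsym : forall x y, d x y = d y x.
Hypothesis dtri : forall y x z, d x z <= d x y + d y z.
Implicit Types (u v w : nat -> T) (xi eta : completion d).

Lemma pdist_ge0 x y : 0 <= d x y.
Proof. by have := dtri y x x; rewrite dxx (dsym y x); lra. Qed.
Hint Resolve pdist_ge0 : core.

Lemma cauchy_class_refl u : cauchy_seq d u -> cauchy_class d u u.
Proof.
move=> cu; split=> //; apply/cvg0P => // e e0.
by exists 0%N => n _; rewrite dxx.
Qed.

Lemma cauchy_class_sub u v w :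
  cauchy_class d u v -> cauchy_class d u w -> cauchy_class d v w.
Proof.
move=> [cv uv] [cw uw]; split=> //.
apply: squeeze0 => [n|n|]; [exact: pdist_ge0|exact: dtri (u n) _ _|].
rewrite -[0](addr0 0); apply: cvgD uw; rewrite (_ : (fun n => d (v n) (u n)) = fun n => d (u n) (v n))//.
by apply/funext => n; rewrite dsym.
Qed.

Lemma cauchy_class_sym u v : cauchy_seq d u ->
  cauchy_class d u v -> cauchy_class d v u.
Proof. by move=> cu uv; exact: cauchy_class_sub uv (cauchy_class_refl cu). Qed.

Lemma cauchy_class_eq u v : cauchy_seq d u ->
  cauchy_class d u v -> cauchy_class d u = cauchy_class d v.
Proof.
move=> cu uv; apply/seteqP; split=> w; first exact: cauchy_class_sub uv.
by apply: cauchy_class_sub; exact: cauchy_class_sym.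
Qed.

Lemma completion_eq xi eta : class_of xi = class_of eta -> xi = eta.
Proof.
case: xi eta => [A hA] [B hB] /= AB; rewrite AB in hA *.
by rewrite (Prop_irrelevance hA hB).
Qed.

Definition completion_of u (cu : cauchy_seq d u) : completion d :=
  Completion (ex_intro2 _ _ u cu erefl).

Lemma class_completion_of u (cu : cauchy_seq d u) :
  class_of (completion_of cu) u.
Proof. exact: cauchy_class_refl. Qed.

Lemma class_reprP xi :
  cauchy_seq d (class_repr xi) /\ class_of xi = cauchy_class d (class_repr xi).
Proof. by rewrite /class_repr; case: cid2. Qed.

Lemma class_of_cauchy xi u : class_of xi u -> cauchy_seq d u.
Proof. by have [_ ->] := class_reprP xi; case. Qed.

Lemma class_of_repr xi : class_of xi (class_repr xi).
Proof. by have [c ->] := class_reprP xi; exact: cauchy_class_refl. Qed.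

Lemma class_ofE xi u : class_of xi u -> class_of xi = cauchy_class d u.
Proof. by have [c ->] := class_reprP xi; exact: cauchy_class_eq. Qed.

Lemma class_of_inj xi eta u : class_of xi u -> class_of eta u -> xi = eta.
Proof. by move=> xiu etau; apply: completion_eq; rewrite (class_ofE xiu) (class_ofE etau). Qed.

(** This frees [completion_dist] from the chosen representatives: any members of the two classes
    compute it, and the limit exists because the distances form a real Cauchy sequence. *)
Lemma completion_dist_cvg xi eta u v : class_of xi u -> class_of eta v ->
  d (u n) (v n) @[n --> \oo] --> completion_dist xi eta.
Proof.
move=> xiu etav.
set p := class_repr xi; set q := class_repr eta.
have [cp pE] := class_reprP xi; have [cq qE] := class_reprP eta.
have pu : cauchy_class d p u by rewrite -pE.
have qv : cauchy_class d q v by rewrite -qE.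
have cpq : cvgn (fun n => d (p n) (q n)).
  apply: R_complete; apply/cauchyP => /= e e0.
  have e2 : 0 < e / 2 by rewrite divr_gt0.
  have [N1 N1P] := cp _ e2; have [N2 N2P] := cq _ e2.
  exists (d (p (maxn N1 N2)) (q (maxn N1 N2))); exists (maxn N1 N2) => // n /= Nn.
  rewrite /ball /= ltr_norml.
  have {}N1P := N1P n (maxn N1 N2); have {}N2P := N2P n (maxn N1 N2).
  set N := maxn N1 N2 in N1P N2P Nn *.
  have N1n : (N1 <= n)%N by rewrite (leq_trans _ Nn)// leq_maxl.
  have N2n : (N2 <= n)%N by rewrite (leq_trans _ Nn)// leq_maxr.
  have {}N1P := N1P N1n (leq_maxl _ _); have {}N2P := N2P N2n (leq_maxr _ _).
  have := dtri (p N) (p n) (q n); have := dtri (q N) (p N) (q n).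
  have := dtri (p n) (p N) (q N); have := dtri (q n) (p n) (q N).
  by rewrite (dsym (p N) (p n)) (dsym (q N) (q n)) => *; apply/andP; split; lra.
have -> : completion_dist xi eta = 0 + limn (fun n => d (p n) (q n)) by rewrite add0r.
(* Changing representatives alters the distances by a null sequence, at most
   [d (p n) (u n) + d (q n) (v n)]. *)
have -> : (fun n => d (u n) (v n)) =
    (fun n => (d (u n) (v n) - d (p n) (q n)) + d (p n) (q n)).
  by apply/funext => n; rewrite subrK.
apply: cvgD cpq; apply/norm_cvg0P.
apply: (squeeze0 (t := fun n => d (p n) (u n) + d (q n) (v n))) => // [n|].
  have := dtri (p n) (u n) (v n); have := dtri (q n) (p n) (v n).
  have := dtri (u n) (p n) (q n); have := dtri (v n) (u n) (q n).
  by rewrite ler_norml (dsym (v n)) (dsym (u n) (p n)) => *; apply/andP; split; lra.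
by rewrite -[0](addr0 0); apply: cvgD; [case: pu|case: qv].
Qed.

Lemma completion_dist_ge0 xi eta : 0 <= completion_dist xi eta.
Proof.
have h := completion_dist_cvg (class_of_repr xi) (class_of_repr eta).
by apply: (cvgr_to_ge h) => //; exact: nearW.
Qed.

Lemma completion_distxx xi : completion_dist xi xi = 0.
Proof.
have := completion_dist_cvg (class_of_repr xi) (class_of_repr xi).
under eq_fun do rewrite dxx.
by move=> /cvg_unique; apply => //; exact: cvg_cst.
Qed.

Lemma completion_dist_eq0 xi eta : completion_dist xi eta = 0 -> xi = eta.
Proof.
move=> h; have := completion_dist_cvg (class_of_repr xi) (class_of_repr eta).
rewrite h => h0; apply: (@class_of_inj _ _ (class_repr eta)).
  have [_ ->] := class_reprP xi; split=> //; exact: class_of_cauchy (class_of_repr eta).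
exact: class_of_repr.
Qed.

Lemma completion_inP x u : cauchy_seq d u ->
  d (u n) x @[n --> \oo] --> (0 : R) -> class_of (completion_in dxx x) u.
Proof.
move=> cu ux; rewrite /completion_in /=; split=> //.
rewrite (_ : (fun n => d x (u n)) = (fun n => d (u n) x))//.
by apply/funext => n.
Qed.

(** Replaces convergence in the completion by membership in a class, the form used for rays
    below. *)
Lemma converges_toP u xi : converges_to dxx u xi <-> class_of xi u.
Proof.
have cin k v : class_of xi v ->
    d (u k) (v n) @[n --> \oo] --> completion_dist (completion_in dxx (u k)) xi.
  apply: completion_dist_cvg; apply: completion_inP; first exact: cauchy_cst.
  by rewrite dxx; exact: cvg_cst.
pose v := class_repr xi; have xiv : class_of xi v := class_of_repr xi.
split=> [/cvg0P h|xiu].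
  have {h} h e : 0 < e -> exists N, forall n, (N <= n)%N -> d (v n) (u n) < e.
    move=> e0; have e3 : 0 < e / 3 by rewrite divr_gt0.
    have [|N1 N1P] := h _ _ e3; first by move=> n; exact: completion_dist_ge0.
    have [N2 N2P] := class_of_cauchy xiv e3.
    exists (maxn N1 N2) => n; rewrite geq_max => /andP[n1 n2].
    have /cvgrPdist_lt/(_ _ e3)[N3 _ N3P] := cin n _ xiv.
    (* [k] may depend on [n]: it only makes [d (u n) (v k)] close to the distance from [u n] to
       [xi], while [v k] stays close to [v n]. *)
    pose k := maxn N2 N3.
    have := N3P k (leq_maxr _ _); rewrite /= ltr_norml => /andP[k1 k2].
    have := N1P n n1; have := N2P n k n2 (leq_maxl _ _).
    have := dtri (v k) (v n) (u n); rewrite (dsym (v k)).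
    by lra.
  rewrite (class_ofE xiv); split; last exact/cvg0P.
  move=> e e0; have e3 : 0 < e / 3 by rewrite divr_gt0.
  have [N1 N1P] := h _ e3; have [N2 N2P] := class_of_cauchy xiv e3.
  exists (maxn N1 N2) => i j; rewrite !geq_max => /andP[i1 i2] /andP[j1 j2].
  have := N1P i i1; have := N1P j j1; have := N2P i j i2 j2.
  have := dtri (v i) (u i) (u j); have := dtri (v j) (v i) (u j).
  by rewrite (dsym (u i) (v i)); lra.
apply/cvg0P => [n|e e0]; first exact: completion_dist_ge0.
have e2 : 0 < e / 2 by rewrite divr_gt0.
have [N NP] := class_of_cauchy xiu e2; exists N => n Nn.
apply: (@le_lt_trans _ _ (e / 2)); last by rewrite ltr_pdivrMr// mulr_natr mulr2n ltrDl.
apply: (cvgr_to_le (cin n _ xiu)) => //; exists N => // k /= Nk.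
by apply/ltW; exact: NP.
Qed.

End PseudometricCompletion.

(** * Diameters and distances of sets in a metric space *)

Section MetricSets.
Context {R : realType} {M : metricType R}.
Implicit Types A B : set M.

Lemma mdist_continuous (p : M) : continuous (mdist p : M -> R).
Proof.
move=> q; apply/cvgrPdist_lt => e e0; near=> r.
have qr : mdist q r < e.
  by near: r; apply/metricType_numDomainType.nbhs_mdistP; exists e.
have := metric_triangle p q r; have := metric_triangle p r q.
by rewrite (metric_sym r q) ltr_norml => *; apply/andP; split; lra.
Unshelve. all: by end_near. Qed.

Lemma compact_mdist_bounded A : compact A ->
  exists B : R, forall p q, A p -> A q -> mdist p q <= B.
Proof.
have [->|/set0P[p0 Ap0]] := eqVneq A set0; first by exists 0.
move=> cA; have : compact (mdist p0 @` A).
  apply: continuous_compact cA; apply: continuous_subspaceT.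
  exact: mdist_continuous.
move=> /(@compact_bounded _ R^o)[B [_ BP]].
have {}BP p : A p -> mdist p0 p <= B + 1.
  move=> Ap; apply: le_trans (ler_norm _) _.
  by apply: (BP (B + 1)); [rewrite ltrDl|exact: imageP].
exists (B + 1 + (B + 1)) => p q Ap Aq.
by rewrite (le_trans (metric_triangle p p0 q))// metric_sym lerD ?BP.
Qed.

Lemma mdist_le_diameter A p q : compact A -> A p -> A q -> mdist p q <= diameter A.
Proof.
move=> /compact_mdist_bounded[B BP] Ap Aq; apply: ub_le_sup; last by exists p, q.
by exists B => _ [p' [q' [Ap' Aq' ->]]]; exact: BP.
Qed.

Lemma set_dist_le A B p q : A p -> B q -> set_dist A B <= mdist p q.
Proof.
move=> Ap Bq; apply: ge_inf; last by exists p, q.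
by exists 0 => _ [p' [q' [_ _ ->]]]; exact: mdist_ge0.
Qed.

Lemma le_set_dist A B (c : R) : A !=set0 -> B !=set0 ->
  (forall p q, A p -> B q -> c <= mdist p q) -> c <= set_dist A B.
Proof.
move=> [p Ap] [q Bq] cP; apply: lb_le_inf; first by exists (mdist p q), p, q.
by move=> _ [p' [q' [Ap' Bq' ->]]]; exact: cP.
Qed.

Lemma set_distC A B : set_dist A B = set_dist B A.
Proof.
rewrite /set_dist; congr (inf _); apply/seteqP.
by split=> _ [p [q [? ? ->]]]; exists q, p; rewrite metric_sym.
Qed.

End MetricSets.

(** * Metric estimates in the AI-graph; departing property and hyperbolicity *)

Section AIGraph.
Context {R : realType} {M : metricType R} {X : countType}.
Variables (Ev : rel X) (o : X) (Phi : X -> set M) (b gamma : R).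
Hypothesis hgraph : rooted_graph Ev.
Hypothesis hvert : vertical Ev o.
Hypothesis hindex : is_index_map Ev o Phi.
Hypothesis hb : 0 < b.
Hypothesis htype : exponential_type Ev o Phi b.
Hypothesis hgamma : 0 < gamma.

Local Notation lv := (level Ev o).
Local Notation G := (AI_graph Ev o Phi b gamma).
Local Notation w t := (expR (- b * t)).
Local Notation gp := (gromov_prod (R := R) G o).
Local Notation conn := (graph_conn hgraph).

Lemma le_w s t : s <= t -> w t <= w s.
Proof. by move=> st; rewrite ler_expR !mulNr lerN2 ler_pM2l. Qed.

Lemma Phi_compact x : compact (Phi x).
Proof. by case: hindex. Qed.

Lemma Phi_descendants m x y : descendants Ev o m x y -> Phi y `<=` Phi x.
Proof.
elim: m y => [|m IHm] y; first by move=> /(descendantsP conn)[_ /joined_nil ->].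
rewrite -addn1 => /(descendants_split conn)[z /IHm xz zy].
exact: subset_trans (index_sub hindex zy) xz.
Qed.

Lemma ver_edge_descendants x y : Ev x y ->
  descendants Ev o 1 x y \/ descendants Ev o 1 y x.
Proof.
move=> xy; have yx : Ev y x by rewrite (graph_sym hgraph).
have /andP[_ nhor] : ver_edge Ev o x y by rewrite -hvert.
have neq : lv x != lv y by apply: contraNneq nhor => e; apply/andP; rewrite e.
have /(level_joined o conn) := (joined1P Ev x y).2 xy.
have /(level_joined o conn) := (joined1P Ev y x).2 yx.
move=> le1 le2.
have [lt|le] := ltnP (lv x) (lv y).
  by left; apply/(descendantsP conn); split; [lia|exact/joined1P].
by right; apply/(descendantsP conn); split; [move: neq; lia|exact/joined1P].
Qed.

Lemma AI_edgeP x y : G x y -> Ev x y \/ lv x = lv y /\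
  set_dist (Phi x) (Phi y) <= gamma * w (lv x)%:R.
Proof. by move=> /orP[|/and4P[_ /eqP ? _ ?]]; [left|right]. Qed.

Lemma AI_sym : symmetric G.
Proof.
move=> x y; rewrite /AI_graph /= (graph_sym hgraph); congr (_ || _).
have [e|_] := eqVneq (lv x) (lv y); last by rewrite /= !andbF.
by rewrite e set_distC eq_sym.
Qed.

Lemma AI_sub : subrel Ev G.
Proof. by move=> x y xy; apply/orP; left. Qed.

Lemma AI_conn x y : exists n, joined G x y n.
Proof. by have [n xy] := conn x y; exists n; exact: joined_sub AI_sub xy. Qed.

Lemma AI_joined_level x y n : joined G x y n -> (lv y <= lv x + n)%N.
Proof.
elim: n y => [y /joined_nil ->|n IHn y]; first by rewrite addn0.
move=> /joinedSP[z /IHn xz /AI_edgeP[zy|[zy _]]]; last by lia.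
by have := level_joined o conn ((joined1P _ _ _).2 zy); lia.
Qed.

(** Horizontal edges join vertices of equal level, so they give no shortcut to the root. *)
Lemma level_AI x : level G o x = lv x.
Proof.
apply/eqP; rewrite eqn_leq; apply/andP; split.
  apply: gdist_le; apply: joined_sub AI_sub _.
  by apply: gdist_joined; exact: conn.
by have := AI_joined_level (gdist_joined (AI_conn o x)); rewrite level_root.
Qed.

Lemma hor_AI x y : hor_edge G o x y -> lv x = lv y.
Proof. by move=> /andP[_ /eqP]; rewrite !level_AI. Qed.

Lemma hor_joined_level x y n : joined (hor_edge G o) x y n -> lv x = lv y.
Proof.
elim: n y => [y /joined_nil ->//|n IHn y].
by move=> /joinedSP[z /IHn -> /hor_AI].
Qed.

(** A path whose level rises by its full length has no step to spare for a horizontal edge. *)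
Lemma descendants_AI m x y : descendants G o m x y -> descendants Ev o m x y.
Proof.
move=> /(descendantsP AI_conn); rewrite !level_AI.
elim: m y => [y [yx xy]|m IHm y [yx /joinedSP[z xz zy]]].
  by apply/(descendantsP conn); rewrite yx (joined_nil xy); split=> //; exact: joined0.
have := AI_joined_level ((joined1P _ _ _).2 zy); have := AI_joined_level xz.
move=> le1 le2; have zx : lv z = (lv x + m)%N by lia.
have {}xz := IHm _ (conj zx xz).
rewrite -addn1; apply: (descendants_trans conn xz); apply/(descendantsP conn).
split; first by lia.
by case: (AI_edgeP zy) => [/joined1P//|[]]; lia.
Qed.

Lemma gdist_AIC x y : gdist G x y = gdist G y x.
Proof.
suff le x' y' : (gdist G x' y' <= gdist G y' x')%N by apply/eqP; rewrite eqn_leq !le.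
apply: gdist_le; apply: joined_sym AI_sym _; exact: gdist_joined (AI_conn _ _).
Qed.

Lemma gpC x y : gp x y = gp y x.
Proof. by rewrite /gromov_prod gdist_AIC (addrC (level G o x)%:R). Qed.

Lemma gpE x y : gp x y = ((lv x)%:R + (lv y)%:R - (gdist G x y)%:R) / 2.
Proof. by rewrite /gromov_prod !level_AI. Qed.

Lemma gp_xx x : gp x x = (lv x)%:R.
Proof.
have : (gdist G x x <= 0)%N by apply: gdist_le; exact: joined0.
by rewrite gpE leqn0 => /eqP ->; rewrite subr0; lra.
Qed.

Lemma gp_le x y : gp x y <= (lv x)%:R.
Proof.
have := AI_joined_level (gdist_joined (AI_conn x y)).
by rewrite gpE -(ler_nat R) natrD; lra.
Qed.

Lemma gp_descendants m x y : descendants Ev o m x y -> gp x y = (lv x)%:R.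
Proof.
move=> /(descendantsP conn)[yx xy]; apply/eqP; rewrite eq_le gp_le /=.
have := gdist_le (joined_sub AI_sub xy).
by rewrite gpE yx natrD -(ler_nat R); lra.
Qed.

(** Extends the asymptotic bound to all levels: below level [N] every [Phi x] lies in the compact
    set [Phi o]. *)
Lemma Phi_diameter : exists2 c : R, 0 < c &
  forall x p q, Phi x p -> Phi x q -> mdist p q <= c * w (lv x)%:R.
Proof.
have [c [N cP]] := htype.
have [B BP] := compact_mdist_bounded (@Phi_compact o).
have w0 t : 0 < w t by exact: expR_gt0.
(* [c] serves the levels from [N] on and [B / w N] the lower ones, where the weight is at least
   [w N]; absolute values and [1] ensure positivity. *)
exists (`|c| + `|B| / w N%:R + 1) => [|x p q xp xq].
  by rewrite ltr_wpDl// addr_ge0// divr_ge0// ltW.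
have [Nx|xN] := leqP N (lv x).
  apply: le_trans (mdist_le_diameter (@Phi_compact x) xp xq) _.
  apply: le_trans (cP x Nx) _; rewrite ler_pM2r//.
  have := ler_norm c; have : 0 <= `|B| / w N%:R by rewrite divr_ge0// ltW.
  by lra.
have ox := Phi_descendants (descendants_root o conn x).
apply: le_trans (BP p q (ox _ xp) (ox _ xq)) _.
apply: le_trans (ler_norm B) _.
have : `|B| <= `|B| / w N%:R * w (lv x)%:R.
  rewrite -mulrA ler_peMr// mulrC ler_pdivlMr// mul1r.
  by apply: le_w; rewrite ler_nat ltnW.
have : 0 <= `|c| * w (lv x)%:R by rewrite mulr_ge0// ltW.
by have := w0 (lv x)%:R; rewrite !mulrDl; lra.
Qed.

(** Along a vertical edge the two index sets are nested, and moving up costs a factor [expR b];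
    along a horizontal edge two diameters and the gap [gamma] add up. *)
Lemma mdist_AI_edge : exists2 c : R, 0 < c & forall x y p q,
  G x y -> Phi x p -> Phi y q -> mdist p q <= c * w (lv x)%:R.
Proof.
have [c c0 cP] := Phi_diameter.
have w0 t : 0 < w t by exact: expR_gt0.
have eb : 1 <= expR b by rewrite -expR0 ler_expR ltW.
exists (c * expR b + c * 2 + gamma) => [|x y p q xy xp yq].
  by rewrite !addr_gt0 ?mulr_gt0 ?expR_gt0.
have H1 := w0 (lv x)%:R; set W := w (lv x)%:R in H1 *.
rewrite !mulrDl.
have P1 : 0 <= c * expR b * W by rewrite !mulr_ge0// ltW// expR_gt0.
have P2 : 0 <= c * W by rewrite mulr_ge0// ltW.
have P3 : 0 <= gamma * W by rewrite mulr_ge0// ltW.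
have [/ver_edge_descendants[xy'|yx]|[lxy dxy]] := AI_edgeP xy.
- by have := cP x p q xp (Phi_descendants xy' yq); rewrite -/W; lra.
- have := cP y p q (Phi_descendants yx xp) yq.
  suff -> : w (lv y)%:R = expR b * W by rewrite mulrA; lra.
  have /(descendantsP conn)[lx _] := yx; rewrite /W lx -expRD.
  by congr expR; rewrite natrD; ring.
(* The infimum in [set_dist] is not evaluated at a minimizing pair: the left-hand side is a lower
   bound for all distances between the two sets. *)
- suff : mdist p q - c * W * 2 <= gamma * W by lra.
  apply: le_trans dxy; apply: le_set_dist; [by exists p|by exists q|].
  move=> p' q' xp' yq'; have := cP x p p' xp xp'; have := cP y q' q yq' yq.
  rewrite -lxy -/W; have := metric_triangle p p' q; have := metric_triangle p' q' q.
  by lra.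
Qed.

(* A geometric series along the path, whose vertices have level at least
   [lv x - i] after [i] steps. *)
Lemma mdist_AI_joined : exists2 c : R, 0 < c & forall n x y p q,
  joined G x y n -> Phi x p -> Phi y q -> mdist p q <= c * w ((lv x)%:R - n%:R).
Proof.
have [c c0 cP] := Phi_diameter; have [s s0 sP] := mdist_AI_edge.
have w0 t : 0 < w t by exact: expR_gt0.
have eb : 0 < expR b - 1 by rewrite subr_gt0 -expR0 ltr_expR.
(* Chosen so that [A + s <= A * expR b], which is the induction step, while the summand [c] covers
   the empty path. *)
pose A := s / (expR b - 1) + c.
have AE : A + s <= A * expR b.
  have -> : A * expR b = A + A * (expR b - 1) by ring.
  rewrite lerD2l /A mulrDl divfK ?gt_eqF// lerDl mulr_ge0// ltW//.
have A0 : 0 < A by rewrite addr_gt0// divr_gt0.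
exists A => // n x; elim: n => [|n IHn] y p q.
  move=> /joined_nil <- xp xq; apply: le_trans (cP x p q xp xq) _.
  by rewrite subr0 ler_pM2r// lerDr ltW// divr_gt0.
move=> /joinedSP[z xz zy] xp yq; have [r zr] := index_neq0 hindex z.
have H1 := IHn z p r xz xp zr; have H2 := sP z y r q zy zr yq.
have H3 : w (lv z)%:R <= w ((lv x)%:R - n%:R).
  apply: le_w; have := AI_joined_level (joined_sym AI_sym xz).
  by rewrite -(ler_nat R) natrD; lra.
apply: le_trans (metric_triangle p r q) _.
have -> : w ((lv x)%:R - n.+1%:R) = expR b * w ((lv x)%:R - n%:R).
  by rewrite -expRD; congr expR; rewrite -natr1; ring.
rewrite mulrA; apply: (@le_trans _ _ ((A + s) * w ((lv x)%:R - n%:R))).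
  by rewrite mulrDl lerD// (le_trans H2)// ler_pM2l.
by rewrite ler_pM2r.
Qed.

(* Split a geodesic from [x] to [y] at its vertex closest to the root. *)
Lemma mdist_le_gromov : exists2 c : R, 0 < c & forall x y p q,
  Phi x p -> Phi y q -> mdist p q <= c * w (gp x y).
Proof.
have [c c0 cP] := mdist_AI_joined.
have w0 t : 0 < w t by exact: expR_gt0.
exists (c * (1 + expR b)) => [|x y p q xp yq].
  by rewrite mulr_gt0// addr_gt0// expR_gt0.
have xy := gdist_joined (AI_conn x y); have := gpE x y.
set n := gdist G x y in xy * => gpn.
have le1 := AI_joined_level xy; have le2 := AI_joined_level (joined_sym AI_sym xy).
(* Without rounding, [lv x - j] and [lv y - (n - j)] would both equal [gp x y]. Rounding lowers the
   second by at most 1/2, which the factor [expR b] absorbs. *)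
pose j := ((lv x + n - lv y)./2)%N.
have jn : (j <= n)%N by rewrite /j; lia.
have H1 : (j.*2 <= lv x + n - lv y <= j.*2.+1)%N by rewrite /j; lia.
have [z xz zy] : exists2 z, joined G x z j & joined G z y (n - j).
  by apply: joined_split; rewrite subnKC.
have [r zr] := index_neq0 hindex z.
have {H1} [H1 H2] : 2 * j%:R <= (lv x)%:R + n%:R - (lv y)%:R :> R /\
    (lv x)%:R + n%:R - (lv y)%:R <= 2 * j%:R + 1 :> R.
  have h1 : (j + j + lv y <= lv x + n)%N by lia.
  have h2 : (lv x + n <= j + j + 1 + lv y)%N by lia.
  by move: h1 h2; rewrite -!(ler_nat R) !natrD; lra.
apply: le_trans (metric_triangle p r q) _; rewrite mulrDr mulr1 mulrDl lerD//.
  apply: le_trans (cP _ _ _ _ _ xz xp zr) _; rewrite ler_pM2l//.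
  by apply: le_w; rewrite gpn; lra.
rewrite metric_sym; apply: le_trans (cP _ _ _ _ _ (joined_sym AI_sym zy) yq zr) _.
rewrite -mulrA ler_pM2l// -expRD natrB//.
have -> : b + - b * gp x y = - b * (gp x y - 1) by ring.
by apply: le_w; rewrite gpn; lra.
Qed.

Lemma AI_edge_of_mdist x y p q : lv x = lv y -> (1 <= lv x)%N -> x != y ->
  Phi x p -> Phi y q -> mdist p q <= gamma * w (lv x)%:R -> G x y.
Proof.
move=> lxy x1 xy xp yq pq; apply/orP; right.
by rewrite x1 xy lxy eqxx /= -lxy (le_trans (set_dist_le xp yq)).
Qed.

Lemma level_eq0 x : lv x = 0%N -> x = o.
Proof.
by move=> x0; have := gdist_joined (conn o x); rewrite -/(lv x) x0 => /joined_nil.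
Qed.

(* At the largest level [h] at which the ancestors of [x] and [y] are forced to
   be equal or adjacent, [gp x y] is at least [h - 1/2]. *)
Lemma gromov_le_mdist : exists2 c : R, 0 < c & forall x y p q,
  Phi x p -> Phi y q -> w (gp x y) <= c * (mdist p q + w (lv x)%:R + w (lv y)%:R).
Proof.
have w0 t : 0 < w t by exact: expR_gt0.
have eb0 : 0 < expR b by exact: expR_gt0.
have eg0 : 0 < expR b / gamma by rewrite divr_gt0.
exists (expR b * (expR b / gamma + 1)) => [|x y p q xp yq].
  by rewrite mulr_gt0// addr_gt0.
pose P h := [&& (h <= lv x)%N, (h <= lv y)%N & (h == 0%N) || (mdist p q <= gamma * w h%:R)].
have exP : exists h, P h by exists 0%N.
have ubP h : P h -> (h <= lv x)%N by case/and3P.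
case: (ex_maxnP exP ubP) => h /and3P[hx hy hP] hmax.
have gph : h%:R - 1 <= gp x y.
  have := descendants_root o conn x; have := descendants_root o conn y.
  rewrite -{1}(subnKC hx) -{1}(subnKC hy).
  move=> /(descendants_split conn)[y' oy' yy'] /(descendants_split conn)[x' ox' xx'].
  have /(descendantsP conn)[lx' _] := ox'; have /(descendantsP conn)[ly' _] := oy'.
  rewrite level_root add0n in lx' ly'.
  have [n n1 xy'] : exists2 n, (n <= 1)%N & joined G x' y' n.
    have [->|ne] := eqVneq x' y'; first by exists 0%N => //; exact: joined0.
    exists 1%N => //; apply/joined1P.
    case/orP: hP => [/eqP h0|pq].
      by move: ne; rewrite (level_eq0 (etrans lx' h0)) (level_eq0 (etrans ly' h0)) eqxx.
    have [h0|h0] := eqVneq h 0%N.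
      by move: ne; rewrite (level_eq0 (etrans lx' h0)) (level_eq0 (etrans ly' h0)) eqxx.
    apply: (AI_edge_of_mdist (p := p) (q := q)); rewrite ?lx' ?ly' ?lt0n//.
      exact: Phi_descendants xx' _ xp.
    exact: Phi_descendants yy' _ yq.
  have /(descendantsP conn)[_ /(joined_sub AI_sub) jx] := xx'.
  have /(descendantsP conn)[_ /(joined_sub AI_sub) jy] := yy'.
  have := gdist_le (joined_cat (joined_cat (joined_sym AI_sym jx) xy') jy).
  rewrite gpE; move: n1; rewrite -!(ler_nat R) !natrD !natrB//; lra.
apply: (@le_trans _ _ (expR b * w h%:R)).
  rewrite -expRD; have -> : b + - b * h%:R = - b * (h%:R - 1) by ring.
  exact: le_w.
rewrite -mulrA ler_pM2l//.
have D0 := mdist_ge0 p q; have W1 := w0 (lv x)%:R; have W2 := w0 (lv y)%:R.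
have N1 : 0 <= expR b / gamma * (mdist p q + w (lv x)%:R + w (lv y)%:R).
  by rewrite mulr_ge0 ?addr_ge0// ltW.
rewrite mulrDl mul1r.
have [hx1|hx1] := eqVneq h (lv x); first by rewrite {1}hx1; lra.
have [hy1|hy1] := eqVneq h (lv y); first by rewrite {1}hy1; lra.
(* When [h] lies below both levels, only the metric condition can fail at [h.+1], and this bounds
   [w h] by a multiple of [mdist p q]. *)
have nP : ~~ P h.+1 by apply/negP => /hmax; rewrite ltnn.
have {nP} : gamma * w h.+1%:R < mdist p q.
  move: nP; rewrite /P !ltn_neqAle hx1 hy1 hx hy /= => /negP nP.
  by rewrite ltNge; apply/negP.
have -> : w h.+1%:R = w h%:R / expR b.
  by rewrite -expRN -expRD; congr expR; rewrite -natr1; ring.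
rewrite mulrA ltr_pdivrMr// => H.
have {}H : w h%:R <= expR b / gamma * mdist p q.
  by rewrite mulrAC ler_pdivlMr// mulrC (mulrC (expR b)) ltW.
have : 0 <= expR b / gamma * w (lv x)%:R by rewrite mulr_ge0// ltW.
have : 0 <= expR b / gamma * w (lv y)%:R by rewrite mulr_ge0// ltW.
by rewrite !mulrDr; lra.
Qed.

(** If descendants [u] and [v] are joined by at most two horizontal steps, points of [Phi u] and
    [Phi v] are so close that [x] and [y], whose index sets contain these points, are equal or
    adjacent. *)
Lemma AI_departing : exists2 m, (1 <= m)%N & departing G o m 1.
Proof.
have [c c0 cP] := mdist_AI_joined.
have [m mP] : exists m : nat, c * w (m%:R - 2) <= gamma.
  (* The inequality is equivalent to [ln (c / gamma) / b + 2 <= m]; the 2 stands for the two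
     horizontal steps. *)
  exists (Num.trunc (`|ln (c / gamma) / b + 2|)).+1.
  set m := _.+1; have : ln (c / gamma) / b + 2 <= m%:R.
    rewrite (le_trans (ler_norm _))// ltW//; exact: truncnS_gt.
  rewrite -lerBrDr ler_pdivrMr// => H.
  have E : gamma / c = expR (- ln (c / gamma)).
    by rewrite expRN lnK ?posrE ?divr_gt0// invf_div.
  by rewrite mulrC -ler_pdivlMr// E ler_expR mulNr lerN2 (mulrC b).
exists m.+1 => // x y /edist_gtP xy u v /descendants_AI xu /descendants_AI yv.
apply/edist_gtP => n uv; rewrite ltnNge; apply/negP => n2.
have /(descendantsP conn)[lu _] := xu; have /(descendantsP conn)[lw _] := yv.
have luv := hor_joined_level uv; have lxy : lv x = lv y by lia.
have [p up] := index_neq0 hindex u; have [q vq] := index_neq0 hindex v.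
have pq : mdist p q <= gamma * w (lv x)%:R.
  have uvG : joined G u v n by apply: joined_sub uv => ? ? /andP[].
  apply: le_trans (cP _ _ _ _ _ uvG up vq) _.
  apply: (@le_trans _ _ (c * (w (m%:R - 2) * w (lv x)%:R))); last first.
    by rewrite mulrA ler_pM2r// expR_gt0.
  rewrite ler_pM2l// -expRD -mulrDr; apply: le_w.
  by move: n2; rewrite lu natrD -natr1 -(ler_nat R); lra.
have [xy0|ne] := eqVneq x y.
  by have := xy 0%N; rewrite xy0 ltn0 => /(_ (joined0 _ _)).
have x0 : (1 <= lv x)%N.
  rewrite lt0n; apply: contraNneq ne => x0.
  by rewrite (level_eq0 x0) (level_eq0 (etrans (esym lxy) x0)).
suff : joined (hor_edge G o) x y 1 by move=> /xy; rewrite ltnn.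
apply/joined1P; rewrite /hor_edge; apply/andP; split; last by rewrite !level_AI lxy.
exact: AI_edge_of_mdist lxy x0 ne (Phi_descendants xu up) (Phi_descendants yv vq) pq.
Qed.

Lemma AI_hyperbolic : hyperbolic R G o.
Proof.
have [c c0 cP] := mdist_le_gromov; have [k k0 kP] := gromov_le_mdist.
have w0 t : 0 < w t by exact: expR_gt0.
(* Two distances through [r] contribute [c * 2] and the two level terms 2; the final 1 makes [ln K]
   nonnegative. *)
pose K := k * (c * 2 + 2) + 1.
have K0 : 0 < K by rewrite addr_gt0// mulr_gt0// addr_gt0// mulr_gt0.
exists (ln K / b); split.
  apply: divr_ge0; last exact: ltW.
  by rewrite ln_ge0// lerDr ltW// mulr_gt0// addr_gt0// mulr_gt0.
move=> x y z; set h := Num.min _ _.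
have [p xp] := index_neq0 hindex x; have [q yq] := index_neq0 hindex y.
have [r zr] := index_neq0 hindex z.
have h1 : h <= gp x z by rewrite ge_min lexx.
have h2 : h <= gp z y by rewrite ge_min lexx orbT.
have H : w (gp x y) <= K * w h.
  apply: le_trans (kP x y p q xp yq) _.
  have H1 := cP x z p r xp zr; have H2 := cP z y r q zr yq.
  have cw : forall g, h <= g -> c * w g <= c * w h by move=> g hg; rewrite ler_pM2l// le_w.
  have H3 : w (lv x)%:R <= w h by rewrite le_w// (le_trans h1)// gp_le.
  have H4 : w (lv y)%:R <= w h by rewrite le_w// (le_trans h2)// gpC gp_le.
  have H5 := metric_triangle p r q; have := cw _ h1; have := cw _ h2 => H6 H7.
  apply: (@le_trans _ _ (k * (c * 2 + 2) * w h)); last by rewrite ler_pM2r// lerDl.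
  by rewrite -mulrA ler_pM2l// mulrDl; lra.
rewrite lerBlDr -lerBlDl ler_pdivlMr//.
have : w (gp x y) <= expR (ln K + - b * h) by rewrite expRD lnK ?posrE.
by rewrite ler_expR; lra.
Qed.

End AIGraph.

(** Induction on the length of the chain, cut at an edge such that the parts before and after it
    each carry at most half of the total sum. *)
Lemma quasimetric_chain {R : realType} {T : Type} (rho : T -> T -> R) (k : R)
    (c : nat -> T) :
  1 <= k -> k * k <= 2 -> (forall x y, 0 < rho x y) ->
  (forall y x z, rho x z <= k * Num.max (rho x y) (rho y z)) ->
  forall n m, (m < n)%N ->
  rho (c m) (c n) <= 2 * \sum_(m <= i < n) rho (c i) (c i.+1).
Proof.
move=> k1 k2 rho0 rhoM n m; pose s p q := \sum_(p <= i < q) rho (c i) (c i.+1).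
have s0 p q : 0 <= s p q by apply: sumr_ge0 => i _; exact/ltW.
have sD p q r : (p <= q)%N -> (q <= r)%N -> s p r = s p q + s q r.
  by move=> pq qr; rewrite /s (big_cat_nat pq qr).
have sS p : s p p.+1 = rho (c p) (c p.+1) by rewrite /s big_nat1.
rewrite -/(s m n).
have [N] := ubnP (n - m); elim: N n m => // N IH n m nmN mn.
have S0 : 0 < s m n.
  by rewrite (sD m m.+1)// sS ltr_pwDl.
(* For the last such [p], the sum from [p.+1] on is also at most half, so by induction both outer
   parts, and trivially the edge between them, have [rho] at most the total. *)
pose P p := [&& (m <= p)%N, (p <= n)%N & s m p <= s m n / 2].
have exP : exists p, P p.
  exists m; rewrite /P leqnn (ltnW mn) /= {1}/s big_geq//.
  by rewrite divr_ge0// ltW.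
have ubP p : P p -> (p <= n)%N by case/and3P.
case: (ex_maxnP exP ubP) => p /and3P[mp pn sp] pmax.
have {}pn : (p < n)%N.
  rewrite ltn_neqAle pn andbT; apply: contraTneq sp => ->.
  by rewrite -ltNge ltr_pdivrMr//; lra.
have sp1 : s m n / 2 < s m p.+1.
  rewrite ltNge; apply/negP => sle.
  have : P p.+1 by rewrite /P pn sle (leq_trans mp).
  by move=> /pmax; rewrite ltnn.
have eqS := sD m p.+1 n (leq_trans mp (leqnSn p)) pn.
have eqS' := sD m p p.+1 mp (leqnSn p).
rewrite sS in eqS'; have s0mp := s0 m p; have s0pn := s0 p.+1 n.
have B : rho (c p) (c p.+1) <= s m n by lra.
have A : (m < p)%N -> rho (c m) (c p) <= s m n.
  move=> mp'; apply: le_trans (IH _ _ _ mp') _; first by lia.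
  by rewrite -/(s m p); lra.
have C : (p.+1 < n)%N -> rho (c p.+1) (c n) <= s m n.
  move=> pn'; apply: le_trans (IH _ _ _ pn') _; first by lia.
  by rewrite -/(s p.+1 n); lra.
set S := s m n in S0 A B C *.
have kS : S <= k * S by rewrite ler_peMl// ltW.
have kkS : k * (k * S) <= 2 * S by rewrite mulrA ler_pM2r.
have k0 : 0 < k by lra.
have kkS' : k * S <= k * (k * S) by rewrite ler_pM2l.
(* The middle edge is joined to the right part first and the result to the left part, so [k] is paid
   at most twice and [k * k <= 2] suffices. *)
have D : rho (c p) (c n) <= k * S.
  have [pn'|] := ltnP p.+1 n.
    apply: le_trans (rhoM (c p.+1) _ _) _.
    by rewrite ler_pM2l// ge_max B C.
  move=> np; have <- : p.+1 = n by apply/eqP; rewrite eqn_leq np pn.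
  exact: le_trans kS.
have [mp'|pm] := ltnP m p; last by have -> : m = p; [by apply/eqP; rewrite eqn_leq mp pm|lra].
apply: le_trans (rhoM (c p) _ _) _; apply: le_trans kkS.
by rewrite ler_pM2l// ge_max D (le_trans (A mp')).
Qed.

(** * The Gromov metric and its comparison with the Gromov product *)

Section GromovMetric.
Context {R : realType} {X : countType}.
Variables (E : rel X) (o : X) (a : R).
Hypothesis gpC : forall x y, gromov_prod (R := R) E o x y = gromov_prod E o y x.

Local Notation rho x y := (expR (- a * gromov_prod E o x y)).
Local Notation theta := (theta E o a).

Definition chain_sums x y : set R :=
  [set s : R | exists n (c : nat -> X), [/\ (1 <= n)%N, c 0%N = x, c n = y &
     s = \sum_(i < n) rho (c i) (c i.+1)]].

Lemma thetaE x y : theta x y = if x == y then 0 else inf (chain_sums x y).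
Proof. by []. Qed.

Lemma chain_sums_ge0 x y s : chain_sums x y s -> 0 <= s.
Proof. by move=> [n [c [_ _ _ ->]]]; apply: sumr_ge0 => i _; exact: expR_ge0. Qed.

Lemma chain_sums1 x y : chain_sums x y (rho x y).
Proof.
exists 1%N, (fun i => if i == 0%N then x else y); split=> //.
by rewrite big_ord1.
Qed.

Lemma chain_sums_has_inf x y : has_inf (chain_sums x y).
Proof.
split; first by exists (rho x y); exact: chain_sums1.
by exists 0 => s; exact: chain_sums_ge0.
Qed.

Lemma chain_sumsD x y z s t :
  chain_sums x y s -> chain_sums y z t -> chain_sums x z (s + t).
Proof.
move=> [n [c [n0 cx cy ->]]] [m [e [m0 ey ez ->]]].
exists (n + m)%N, (fun i => if (i <= n)%N then c i else e (i - n)%N).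
rewrite leq0n; split=> //; first by rewrite addn_gt0 n0.
  by rewrite ifN ?addKn// -ltnNge -{1}[n]addn0 ltn_add2l.
rewrite big_split_ord /=; congr (_ + _); apply: eq_bigr => i _ /=.
  by rewrite ltnW//= ltn_ord.
rewrite ltnNge leq_addr /= subSn ?leq_addr// addKn.
case: leqP => //; rewrite -{2}[n]addn0 leq_add2l leqn0 => /eqP i0.
by rewrite i0 addn0 cy ey.
Qed.

Lemma chain_sumsC x y s : chain_sums x y s -> chain_sums y x s.
Proof.
move=> [n [c [n0 cx cy ->]]]; exists n, (fun i => c (n - i)%N).
rewrite subn0 subnn; split=> //; rewrite (reindex_inj rev_ord_inj) /=.
apply: eq_bigr => i _; by rewrite gpC subnSK.
Qed.

Lemma theta_ge0 x y : 0 <= theta x y.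
Proof.
rewrite thetaE; case: eqP => // _.
by apply: lb_le_inf; [case: (chain_sums_has_inf x y)|exact: chain_sums_ge0].
Qed.

Lemma theta_le x y : theta x y <= rho x y.
Proof.
rewrite thetaE; case: eqP => [_|_]; first exact: expR_ge0.
by apply: ge_inf; [case: (chain_sums_has_inf x y)|exact: chain_sums1].
Qed.

Lemma theta_sym x y : theta x y = theta y x.
Proof.
rewrite !thetaE eq_sym; case: eqP => // _; congr inf.
by apply/seteqP; split=> s; exact: chain_sumsC.
Qed.

(** Chains concatenate; coinciding points are treated apart because [theta] is set to 0 on the
    diagonal. *)
Lemma theta_tri y x z : theta x z <= theta x y + theta y z.
Proof.
have [->|xy] := eqVneq x y; first by rewrite theta_xx add0r.
have [->|yz] := eqVneq y z; first by rewrite theta_xx addr0.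
have [->|xz] := eqVneq x z.
  by rewrite theta_xx addr_ge0 ?theta_ge0.
rewrite !thetaE (negPf xy) (negPf yz) (negPf xz) -lerBlDr.
have [nxy _] := chain_sums_has_inf x y; have [nyz _] := chain_sums_has_inf y z.
have [_ bxz] := chain_sums_has_inf x z.
apply: lb_le_inf => // s sxy; rewrite lerBlDl -lerBlDr.
apply: lb_le_inf => // t tyz; rewrite lerBlDl.
apply: ge_inf => //; exact: chain_sumsD sxy tyz.
Qed.

Variable delta : R.
Hypothesis hyp : hyperbolic_with E o delta.
Hypothesis a0 : 0 < a.
Hypothesis delta_a : expR (delta * a) < Num.sqrt 2.

(** Hyperbolicity makes [rho] a quasi-ultrametric with constant [expR (delta * a)], whose square is
    at most 2, so the chain lemma applies to every chain. *)
Lemma gromov_le_theta x y : x != y -> rho x y <= 2 * theta x y.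
Proof.
move=> xy; rewrite thetaE (negPf xy) -ler_pdivrMl//; apply: lb_le_inf.
  by have [] := chain_sums_has_inf x y.
move=> _ [n [c [n0 <- <- ->]]]; rewrite ler_pdivrMl//.
have [d0 dP] := hyp.
have sq2 : 0 <= Num.sqrt 2 :> R by exact: sqrtr_ge0.
rewrite -(big_mkord xpredT (fun i => rho (c i) (c i.+1))).
apply: (@quasimetric_chain _ _ (fun x y => rho x y) (expR (delta * a))) => //.
- by rewrite -expR0 ler_expR mulr_ge0// ltW.
- apply: (@le_trans _ _ (Num.sqrt 2 * Num.sqrt 2)).
    by rewrite ler_pM ?expR_ge0// ltW.
  by rewrite -expr2 sqr_sqrtr.
- by move=> *; exact: expR_gt0.
move=> v u w; rewrite maxr_pMr ?expR_ge0// -!expRD le_max !ler_expR.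
have := dP u w v; have := ltW a0.
rewrite minEle; case: ifP => _ a0' H; apply/orP; [left|right].
  have : 0 <= a * (gromov_prod E o u w - (gromov_prod E o u v - delta)).
    by rewrite mulr_ge0// subr_ge0.
  by rewrite !mulrBr; lra.
have : 0 <= a * (gromov_prod E o u w - (gromov_prod E o v w - delta)).
  by rewrite mulr_ge0// subr_ge0.
by rewrite !mulrBr; lra.
Qed.

(** The added term covers the diagonal, where [theta] vanishes but [rho] does not; it tends to 0
    along rays. *)
Lemma gromov_le_thetaD x y :
  rho x y <= 2 * theta x y + expR (- a * gromov_prod E o x x).
Proof.
have [->|xy] := eqVneq x y; first by rewrite theta_xx mulr0 add0r.
by apply: ler_wpDr; [exact: expR_ge0|exact: gromov_le_theta].
Qed.

End GromovMetric.

(** * Real powers and exponential decay *)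

Section Powers.
Context {R : realType}.
Implicit Types x y a b t : R.

Lemma expR_powR_div a b x : b != 0 -> expR (- b * x) `^ (a / b) = expR (- a * x).
Proof.
by move=> b0; rewrite /powR gt_eqF ?expR_gt0// expRK; congr expR; field.
Qed.

(** A sum is at most twice its larger term; this also covers exponents above 1, where the power is
    not subadditive. *)
Lemma powRD_le x y t : 0 <= t -> 0 <= x -> 0 <= y ->
  (x + y) `^ t <= 2 `^ t * (x `^ t + y `^ t).
Proof.
move=> t0 x0 y0; rewrite mulrDr -!powRM//.
have mono u v : 0 <= u -> u <= v -> u `^ t <= v `^ t.
  move=> u0 uv; apply: ge0_ler_powR => //; rewrite nnegrE//.
  exact: le_trans uv.
have [xy|yx] := leP x y.
  apply: ler_wpDl; first exact: powR_ge0.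
  by apply: mono; [rewrite addr_ge0|lra].
apply: ler_wpDr; first exact: powR_ge0.
by apply: mono; [rewrite addr_ge0|lra].
Qed.

Lemma expRN_cvg0 a : 0 < a -> expR (- a * n%:R) @[n --> \oo] --> (0 : R).
Proof.
move=> a0; under eq_fun do rewrite mulrC expRM_natl.
by apply: cvg_expr; rewrite ger0_norm ?expR_ge0// expR_lt1 oppr_lt0.
Qed.

End Powers.

(** * Rays, boundary points and the induced map *)

Section AIBoundary.
Context {R : realType} {M : metricType R} {X : countType}.
Variables (Ev : rel X) (o : X) (Phi : X -> set M) (b gamma : R).
Hypothesis hgraph : rooted_graph Ev.
Hypothesis hvert : vertical Ev o.
Hypothesis hindex : is_index_map Ev o Phi.
Hypothesis hb : 0 < b.
Hypothesis htype : exponential_type Ev o Phi b.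
Hypothesis hgamma : 0 < gamma.

Local Notation lv := (level Ev o).
Local Notation G := (AI_graph Ev o Phi b gamma).
Local Notation gp := (gromov_prod (R := R) G o).
Local Notation conn := (graph_conn hgraph).

Variables delta a : R.
Hypothesis hyp : hyperbolic_with G o delta.
Hypothesis a0 : 0 < a.
Hypothesis delta_a : expR (delta * a) < Num.sqrt 2.

Local Notation wa t := (expR (- a * t)).
Local Notation th := (theta G o a).
Let GC := gpC o Phi b gamma hgraph.
Let thxx := theta_xx (R := R) G o a.
Let thC := theta_sym a GC.
Let thtri := @theta_tri R X G o a.
Implicit Types xi eta : completion th.

Lemma le_wa s t : s <= t -> wa t <= wa s.
Proof. by move=> st; rewrite ler_expR !mulNr lerN2 ler_pM2l. Qed.

Lemma wa_small e : 0 < e -> exists N, forall n, (N <= n)%N -> wa n%:R < e.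
Proof.
move=> e0; have [N NP] := (cvg0P (fun n => expR_ge0 _)).1 (expRN_cvg0 a0) e e0.
by exists N.
Qed.

Lemma theta_descendants m x y : descendants Ev o m x y -> th x y <= wa (lv x)%:R.
Proof.
by move=> xy; rewrite -(gp_descendants Phi hgraph hb hgamma xy); exact: theta_le.
Qed.

Lemma gromov_le_theta_level x y : wa (gp x y) <= 2 * th x y + wa (lv x)%:R.
Proof.
by rewrite -(gp_xx o Phi hgraph hb hgamma x); exact: (gromov_le_thetaD hyp a0 delta_a).
Qed.

(** Vertices are isolated in the Gromov metric, with a radius depending on the level only. *)
Lemma theta_neq_lb x y : x != y -> wa (lv x)%:R <= 2 * th x y.
Proof.
move=> xy; apply: le_trans (gromov_le_theta hyp a0 delta_a xy).
by apply: le_wa; exact: gp_le.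
Qed.

Lemma ray_cauchy r : ray Ev o r -> cauchy_seq th r.
Proof.
move=> rr e e0; have [N NP] := wa_small e0; exists N.
suff H i j : (N <= i)%N -> (i <= j)%N -> th (r i) (r j) < e.
  move=> i j Ni Nj; have [ij|/ltnW ji] := leqP i j; first exact: H.
  by rewrite thC; exact: H.
move=> Ni /subnKC <-; apply: le_lt_trans (NP _ Ni).
have := theta_descendants (ray_descendants conn i (j - i) rr).
by rewrite (ray_level conn).
Qed.

(** If the sequence kept returning below level [L], isolation of vertices would make it eventually
    constant, and [xi] would be a vertex. *)
Lemma boundary_level xi u L : boundary G o a xi -> class_of xi u ->
  exists N, forall n, (N <= n)%N -> (L <= lv (u n))%N.
Proof.
move=> bxi xiu; apply: contrapT => /forallNP noN.
have cu := class_of_cauchy xiu.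
have [|N NP] := cu (wa L%:R / 2); first by rewrite divr_gt0// expR_gt0.
have /existsNP[i /not_implyP[Ni /negP]] := noN N; rewrite -ltnNge => iL.
have cst j : (N <= j)%N -> u j = u i.
  move=> Nj; apply: contrapT => /eqP; rewrite eq_sym => ij.
  have := theta_neq_lb ij; have := NP i j Ni Nj.
  have : wa L%:R <= wa (lv (u i))%:R by apply: le_wa; rewrite ler_nat ltnW.
  by lra.
apply: (bxi (u i)); apply: (class_of_inj thxx thC thtri xiu).
apply: completion_inP => //; apply/cvg0P => [n|e e0]; first exact: theta_ge0.
by exists N => n Nn; rewrite cst// theta_xx.
Qed.

Lemma ray_boundary xi r : ray Ev o r -> class_of xi r -> boundary G o a xi.
Proof.
move=> rr xir x xix; move: xir; rewrite xix => -[_ /cvg0P].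
move=> /(_ (fun n => theta_ge0 _ _ _ _ _))/(_ (wa (lv x)%:R / 2)).
case=> [|N NP]; first by rewrite divr_gt0// expR_gt0.
pose n := maxn N (lv x).+1.
have xn : x != r n.
  apply/eqP => xrn; have := ray_level conn n rr; rewrite -xrn /n => H.
  by have := leq_maxr N (lv x).+1; rewrite -H ltnn.
by have := theta_neq_lb xn; have := NP n (leq_maxl _ _); lra.
Qed.

(** Koenig's lemma gives a ray each of whose vertices has descendants arbitrarily late in a Cauchy
    sequence representing [xi]. *)
Lemma boundary_ray xi : boundary G o a xi -> exists2 r, ray Ev o r & class_of xi r.
Proof.
move=> bxi; pose u := class_repr xi.
have xiu : class_of xi u by exact: class_of_repr.
have cu := class_of_cauchy xiu.
pose W n := [set w | (n <= lv w)%N /\ exists2 i, (n <= i)%N & w = u i].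
have W0 n : W n !=set0.
  have [N NP] := boundary_level n bxi xiu.
  exists (u (maxn N n)); split; first exact: NP (leq_maxl _ _).
  by exists (maxn N n) => //; exact: leq_maxr.
have Wlev n w : W n w -> (n <= lv w)%N by case.
have WS n : W n.+1 `<=` W n.
  by move=> w [nw [i ni wi]]; split; [exact: ltnW|exists i => //; exact: ltnW].
have [r rr rW] := konig conn (graph_locfin hgraph) W0 Wlev WS.
exists r => //; rewrite (class_ofE thxx thC thtri xiu); split; first exact: ray_cauchy.
apply/cvg0P => [n|e e0]; first exact: theta_ge0.
have e2 : 0 < e / 2 by rewrite divr_gt0.
have [N1 N1P] := wa_small e2; have [N2 N2P] := cu _ e2.
exists (maxn N1 N2) => n; rewrite geq_max => /andP[N1n N2n].
(* The same [n] is the level of the ray vertex and the start of the tail, so [u i] is close both to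
   [r n] and to [u n]. *)
have [_ [m [[_ [i ni ->]] _ ri]]] := rW n n.
have := theta_descendants ri; rewrite (ray_level conn)// => H1.
have := N1P n N1n; have := N2P n i N2n (leq_trans N2n ni).
have := thtri (u i) (u n) (r n); rewrite (thC (u i) (r n)).
by lra.
Qed.

Lemma tends_toP r xi : tends_to r xi <-> class_of xi r.
Proof. exact: converges_toP. Qed.

(** At each level [n] the comparison holds for [r n] and [s n] up to a multiple of [wa n]; raising
    to the power [a / b] turns the scale of [Phi] into that of [theta], and the error disappears in
    the limit. *)
Lemma ray_holder : exists2 C : R, 1 <= C & forall r s p q xi eta,
  ray Ev o r -> ray Ev o s ->
  (forall i, Phi (r i) p) -> (forall i, Phi (s i) q) ->
  class_of xi r -> class_of eta s ->
  C^-1 * completion_dist xi eta <= mdist p q `^ (a / b) <= C * completion_dist xi eta.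
Proof.
have [c c0 cP] := mdist_le_gromov hgraph hvert hindex hb htype hgamma.
have [k k0 kP] := gromov_le_mdist hgraph hindex hb hgamma.
set t := a / b; have t0 : 0 <= t by rewrite divr_ge0// ltW.
have wt x : expR (- b * x) `^ t = wa x by apply: expR_powR_div; rewrite gt_eqF.
have mono u v : 0 <= u -> u <= v -> u `^ t <= v `^ t.
  by move=> u0 uv; apply: ge0_ler_powR => //; rewrite nnegrE//; exact: le_trans uv.
have C1 : 0 <= c `^ t * 2 by rewrite mulr_ge0// powR_ge0.
have C2 : 0 <= k `^ t * 2 `^ t by rewrite mulr_ge0// powR_ge0.
exists (c `^ t * 2 + k `^ t * 2 `^ t + 1) => [|r s p q xi eta rr ss rp sq xir etas].
  by rewrite lerDr addr_ge0.
have rn n : lv (r n) = n := ray_level conn n rr.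
have sn n : lv (s n) = n := ray_level conn n ss.
have lim := completion_dist_cvg thC thtri xir etas.
have wn0 := expRN_cvg0 a0.
have cd0 := completion_dist_ge0 thxx thC thtri xi eta.
set d := completion_dist xi eta in lim cd0 *.
have up : mdist p q `^ t <= c `^ t * 2 * d.
  have L : c `^ t * (2 * th (r n) (s n) + wa n%:R) @[n --> \oo] --> c `^ t * (2 * d + 0).
    by apply: cvgMr; apply: cvgD wn0; exact: cvgMr.
  rewrite addr0 mulrA in L; apply: (cvgr_to_ge L); apply: nearW => n.
  apply: (@le_trans _ _ (c `^ t * wa (gp (r n) (s n)))).
    rewrite -wt -powRM ?expR_ge0 ?(ltW c0)//.
    by apply: mono; [exact: mdist_ge0|exact: cP].
  rewrite ler_wpM2l ?powR_ge0//.
  by have := gromov_le_theta_level (r n) (s n); rewrite rn.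
have lo : d <= k `^ t * 2 `^ t * mdist p q `^ t.
  have L : k `^ t * (2 `^ t * (mdist p q `^ t + 2 `^ t * wa n%:R)) @[n --> \oo]
      --> k `^ t * (2 `^ t * (mdist p q `^ t + 2 `^ t * 0)).
    by apply: cvgMr; apply: cvgMr; apply: cvgD; [exact: cvg_cst|exact: cvgMr].
  rewrite mulr0 addr0 mulrA in L; apply: (ler_cvg_to lim L); apply: nearW => n.
  apply: le_trans (theta_le _ _ _ _ _) _; rewrite -wt.
  apply: le_trans (mono _ _ (expR_ge0 _) (kP _ _ _ _ (rp n) (sq n))) _.
  rewrite rn sn powRM ?addr_ge0 ?mdist_ge0 ?expR_ge0 ?(ltW k0)//.
  rewrite ler_wpM2l ?powR_ge0// -addrA.
  rewrite -wt -powRM ?expR_ge0// mulr_natl mulr2n.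
  by apply: powRD_le; rewrite ?addr_ge0 ?mdist_ge0 ?expR_ge0.
set A := c `^ t * 2 in C1 up *; set B := k `^ t * 2 `^ t in C2 lo *.
have P0 : 0 <= mdist p q `^ t by exact: powR_ge0.
apply/andP; split; last first.
  apply: le_trans up _; rewrite !mulrDl.
  have : 0 <= B * d by rewrite mulr_ge0.
  by lra.
rewrite mulrC ler_pdivrMr; last by lra.
apply: le_trans lo _; rewrite !mulrDr mulr1 (mulrC B).
have : 0 <= mdist p q `^ t * A by rewrite mulr_ge0.
by lra.
Qed.

Lemma ray_limit r : ray Ev o r ->
  exists p, \bigcap_(i in [set: nat]) Phi (r i) = [set p].
Proof. by case: hindex => _ _ _; apply. Qed.

Lemma bigcap_set1 (r : nat -> X) p :
  \bigcap_(i in [set: nat]) Phi (r i) = [set p] -> forall i, Phi (r i) p.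
Proof. by move=> rp i; have : [set p] p by []; rewrite -rp; apply. Qed.

(** Two rays with the same limit have boundary distance 0, so the Hoelder upper bound identifies
    their points in [M]. *)
Lemma exists_boundary_map : exists kappa : completion th -> M, induces Ev Phi kappa.
Proof.
have [C C1 CP] := ray_holder.
have /choice[kappa kP] : forall xi, exists p, boundary G o a xi ->
    exists r, [/\ ray Ev o r, class_of xi r &
      \bigcap_(i in [set: nat]) Phi (r i) = [set p]].
  (* Off the boundary [kappa] takes an arbitrary value, supplied by the nonempty [Phi o]. *)
  move=> xi; have [bxi|nb] := pselect (boundary G o a xi); last first.
    by have [p _] := index_neq0 hindex o; exists p.
  have [r rr xir] := boundary_ray bxi.
  by have [p rp] := ray_limit rr; exists p => _; exists r.
exists kappa => xi bxi; have [r [rr xir rp]] := kP xi bxi.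
split; first by exists r => //; exact/tends_toP.
move=> s ss /tends_toP xis; have [q sq] := ray_limit ss; rewrite sq; congr [set _].
have /andP[_] := CP _ _ _ _ _ _ rr ss (bigcap_set1 rp) (bigcap_set1 sq) xir xis.
rewrite (completion_distxx thxx thC thtri) mulr0 => le0.
apply/esym/mdist_positivity/(@powR_eq0_eq0 _ _ (a / b))/eqP.
by rewrite eq_le le0 powR_ge0.
Qed.

Lemma induced_map_holder (kappa : completion th -> M) : induces Ev Phi kappa ->
  exists2 C : R, 1 <= C & forall xi eta,
    boundary G o a xi -> boundary G o a eta ->
    C^-1 * completion_dist xi eta
      <= mdist (kappa xi) (kappa eta) `^ (a / b) <= C * completion_dist xi eta.
Proof.
move=> kP; have [C C1 CP] := ray_holder; exists C => // xi eta bxi beta.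
have [[r rr rxi] /(_ r rr rxi) rp] := kP xi bxi.
have [[s ss seta] /(_ s ss seta) sq] := kP eta beta.
apply: CP rr ss (bigcap_set1 rp) (bigcap_set1 sq) _ _; exact/tends_toP.
Qed.

Lemma induced_map_bij (kappa : completion th -> M) : induces Ev Phi kappa ->
  set_bij (boundary G o a) (attractor Ev o Phi) kappa.
Proof.
move=> kP; have [C C1 CP] := induced_map_holder kP; split.
- move=> xi bxi n _; have [[r rr rxi] /(_ r rr rxi) rp] := kP xi bxi.
  by exists (r n); [rewrite /= (ray_level conn)|exact: bigcap_set1].
(* Injectivity: equal images force distance 0 by the lower Hoelder bound. *)
- move=> xi eta /set_mem bxi /set_mem beta kxi.
  have /andP[+ _] := CP xi eta bxi beta.
  rewrite kxi mdistxx powR0; last by rewrite mulf_neq0 ?invr_eq0 ?gt_eqF.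
  rewrite pmulr_rle0 ?invr_gt0; last by lra.
  move=> le0; apply: (completion_dist_eq0 thxx thC thtri); apply/eqP.
  by rewrite eq_le le0 (completion_dist_ge0 thxx thC thtri).
(* Surjectivity: a vertex of the ray given by Koenig's lemma has a descendant whose index set
   contains [p], hence contains [p] in its own by monotonicity. *)
- move=> p Kp; pose W n := [set w | (n <= lv w)%N /\ Phi w p].
  have W0 n : W n !=set0.
    by have [x /= xn xp] := Kp n I; exists x; split=> //; rewrite xn.
  have Wlev n w : W n w -> (n <= lv w)%N by case.
  have WS n : W n.+1 `<=` W n by move=> w [nw wp]; split=> //; exact: ltnW.
  have [r rr rW] := konig conn (graph_locfin hgraph) W0 Wlev WS.
  have rp i : Phi (r i) p.
    by have [w [m [[_ wp] _ riw]]] := rW i 0%N; exact: (Phi_descendants hgraph hindex riw wp).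
  pose xi := completion_of (ray_cauchy rr).
  have xir : class_of xi r by exact: class_completion_of.
  have bxi := ray_boundary rr xir; exists xi => //.
  have [_ /(_ r rr)] := kP xi bxi; rewrite tends_toP => /(_ xir) rk.
  by have : (\bigcap_(i in [set: nat]) Phi (r i)) p by []; rewrite rk => ->.
Qed.

End AIBoundary.

Theorem theorem1p3 (R : realType) (M : completeMetricType R)
    (X : countType) (Ev : rel X) (o : X) (Phi : X -> set M) (b gamma : R)
    (hgraph : rooted_graph Ev) (hvert : vertical Ev o)
    (hdesc : forall x : X, descendants Ev o 1 x !=set0)
    (hindex : is_index_map Ev o Phi)
    (hb : 0 < b) (htype : exponential_type Ev o Phi b) (hgamma : 0 < gamma) :
  [/\ exists2 m : nat, (1 <= m)%N &
        departing (AI_graph Ev o Phi b gamma) o m 1,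
      hyperbolic R (AI_graph Ev o Phi b gamma) o &
      forall (delta a : R),
        hyperbolic_with (AI_graph Ev o Phi b gamma) o delta ->
        0 < a -> expR (delta * a) < Num.sqrt 2 ->
        exists kappa : completion (theta (AI_graph Ev o Phi b gamma) o a) -> M,
          [/\ induces Ev Phi kappa,
              set_bij (boundary (AI_graph Ev o Phi b gamma) o a)
                      (attractor Ev o Phi) kappa &
              exists2 C : R, 1 <= C &
                forall xi eta,
                  boundary (AI_graph Ev o Phi b gamma) o a xi ->
                  boundary (AI_graph Ev o Phi b gamma) o a eta ->
                  C^-1 * completion_dist xi eta
                    <= mdist (kappa xi) (kappa eta) `^ (a / b)
                    <= C * completion_dist xi eta]].
Proof.
split; first exact: AI_departing; first exact: AI_hyperbolic.
move=> delta a hyp a0 delta_a.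
have [kappa kappaP] := exists_boundary_map hgraph hvert hindex hb htype hgamma hyp a0 delta_a.
exists kappa; split=> //.
  exact: induced_map_bij hyp a0 delta_a _ kappaP.
exact: induced_map_holder hyp a0 delta_a _ kappaP.
Qed.
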